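(* Let $A$ be a commutative approximately unital Banach algebra. Any separable closed ideal in $A$ having a bounded approximate identity in ${\mathfrak r}_A$ is of the form $\overline{xA}$ for some $x\in{\mathfrak F}_A$. Also, if $(x_k)_{k\ge1}$ is a sequence in ${\mathfrak F}_A$, then the closure of $\sum_k \overline{x_kA}$ equals $\overline{zA}$, where $z=\sum_{k=1}^\infty 2^{-k}x_k$.
   Context: Banach algebras are complex with submultiplicative norm; ''unital'' means identity of norm 1. Approximately unital: has a contractive approximate identity. Multiplier unitization $A^1$: $A$ if unital, otherwise $A+\mathbb{C}1$ with $\|a+\lambda1\|=\sup\{\|ac+\lambda c\|:c\in A,\|c\|\le1\}$. ${\mathfrak F}_A=\{a\in A:\|1-a\|_{A^1}\le1\}$; ${\mathfrak r}_A=\{a\in A:\mathrm{Re}\,\varphi(a)\ge0$ for all $\varphi\in(A^1)^*$ with $\|\varphi\|=\varphi(1)=1\}$. $\overline{xA}$ is the norm closure of $\{xa:a\in A\}$. *)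

(* Defs.v *)
From mathcomp Require Import all_boot all_algebra.
From mathcomp Require Import all_classical all_reals all_analysis.
From mathcomp Require Export complex.
Export numFieldNormedType.Exports.

Set Implicit Arguments.
Unset Strict Implicit.
Unset Printing Implicit Defensive.
Import GRing.Theory Num.Theory.
Local Open Scope ring_scope.
Local Open Scope classical_set_scope.

Section BanachAlgebra.
Variables (R : realType) (A : completeNormedModType R[i]) (mul : A -> A -> A).

Definition comm_banach_alg : Prop :=
  (forall a b c, mul a (mul b c) = mul (mul a b) c) /\
  (forall a b, mul a b = mul b a) /\
  (forall a b c, mul (a + b) c = mul a c + mul b c) /\
  (forall a b c, mul a (b + c) = mul a b + mul a c) /\
  (forall (k : R[i]) a b, mul (k *: a) b = k *: mul a b) /\
  (forall (k : R[i]) a b, mul a (k *: b) = k *: mul a b) /\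
  (forall a b, `|mul a b| <= `|a| * `|b|).

Definition unit_id (e : A) : Prop :=
  (forall a, mul e a = a /\ mul a e = a) /\ `|e| = 1.

Definition unital : Prop := exists e, unit_id e.

Definition directed_set (I : Type) (le : I -> I -> Prop) : Prop :=
  [/\ (exists i : I, True),
      (forall i, le i i),
      (forall i j k, le i j -> le j k -> le i k) &
      (forall i j, exists k, le i k /\ le j k)].

Definition net_cvg (I : Type) (le : I -> I -> Prop) (u : I -> A) (x : A)
  : Prop :=
  forall eps : R[i], 0 < eps -> exists i0, forall i, le i0 i -> `|u i - x| < eps.

Definition approx_unital : Prop :=
  exists (I : Type) (le : I -> I -> Prop) (e : I -> A),
    [/\ directed_set le,
        (forall i, `|e i| <= 1) &
        (forall a, net_cvg le (fun i => mul (e i) a) a /\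
                   net_cvg le (fun i => mul a (e i)) a)].

(* multiplier unitization A^1 (non-unital case): element a + lam 1 has norm
   sup { |a c + lam c| : |c| <= 1 };  mnorm_le a lam r  <->  that norm <= r *)
Definition mnorm_le (a : A) (lam : R[i]) (r : R[i]) : Prop :=
  forall c, `|c| <= 1 -> `|mul a c + lam *: c| <= r.

(* F_A = { a in A : |1 - a|_{A^1} <= 1 } *)
Definition in_FA (a : A) : Prop :=
  (exists e, unit_id e /\ `|e - a| <= 1) \/
  (~ unital /\ mnorm_le (- a) 1 1).

Definition clinear (f : A -> R[i]) : Prop :=
  (forall a b, f (a + b) = f a + f b) /\ (forall (k : R[i]) a, f (k *: a) = k * f a).

(* states of A^1 when A is unital with identity e (A^1 = A):
   phi in A^*, phi e = 1, ||phi|| = 1 (sup_{|b|<=1} |phi b| = 1) *)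
Definition state_unital (e : A) (phi : A -> R[i]) : Prop :=
  [/\ clinear phi, phi e = 1,
      (forall b, `|phi b| <= `|b|) &
      (forall eps : R[i], 0 < eps -> exists b, `|b| <= 1 /\ 1 - eps < `|phi b|)].

(* states of A^1 when A is non-unital: phi (a + lam 1) = psi a + lam * phi 1
   with phi 1 = 1, psi linear, ||phi|| = 1 w.r.t. the multiplier norm *)
Definition state_nonunital (psi : A -> R[i]) : Prop :=
  [/\ clinear psi,
      (forall a lam r, mnorm_le a lam r -> `|psi a + lam| <= r) &
      (forall eps : R[i], 0 < eps ->
         exists a lam, mnorm_le a lam 1 /\ 1 - eps < `|psi a + lam|)].

Definition in_rA (a : A) : Prop :=
  (forall e, unit_id e -> forall phi, state_unital e phi -> 0 <= Re (phi a)) /\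
  (~ unital -> forall psi, state_nonunital psi -> 0 <= Re (psi a)).

Definition closed_ideal (J : set A) : Prop :=
  [/\ closed J, J 0,
      (forall a b, J a -> J b -> J (a + b)),
      (forall (k : R[i]) a, J a -> J (k *: a)) &
      (forall a b, J b -> J (mul a b) /\ J (mul b a))].

Definition separable_set (J : set A) : Prop :=
  exists d : nat -> A, (forall n, J (d n)) /\ J `<=` closure (range d).

Definition bai_in_rA (J : set A) : Prop :=
  exists (I : Type) (le : I -> I -> Prop) (e : I -> A),
    [/\ directed_set le,
        (forall i, J (e i) /\ in_rA (e i)),
        (exists M : R[i], forall i, `|e i| <= M) &
        (forall j, J j -> net_cvg le (fun i => mul (e i) j) j /\
                          net_cvg le (fun i => mul j (e i)) j)].

Definition cl_xA (x : A) : set A := closure (range (mul x)).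

Definition ideal_sum (x : nat -> A) : set A :=
  [set y | exists (n : nat) (y_ : nat -> A),
     (forall k, (1 <= k <= n)%N -> cl_xA (x k) (y_ k)) /\
     y = \sum_(1 <= k < n.+1) y_ k].

End BanachAlgebra.

(* Main.v *)
From HB Require Import structures.
Require Import Defs.
From mathcomp Require Import all_boot all_order all_algebra.
From mathcomp Require Import all_classical all_reals all_analysis.
From mathcomp Require Import ring lra.
Import numFieldNormedType.Exports.
Import Order.TTheory GRing.Theory Num.Theory.
From mathcomp Require Import complex.

Set Implicit Arguments.
Unset Strict Implicit.
Unset Printing Implicit Defensive.
Local Open Scope ring_scope.
Local Open Scope complex_scope.
Local Open Scope classical_set_scope.

(** An element x of A lies in F_A exactly when 1 - x acts on A as a contraction.
    Since the unit is an extreme point of the unit ball of a unital Banach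
    algebra, two contractions 1 - p and 1 - q whose sum is 2 modulo (p + q)A are
    both 1 modulo the closure of (p + q)A; hence pA lies in that closure.
    Splitting z = 2^-k x_k + (1 - 2^-k) y with y in F_A gives x_kA in the
    closure of zA, which is the second claim.  For the first one, Hahn-Banach
    applied to the one-sided derivative of the norm at 1 shows that every y in
    r_A satisfies |s - y| <= s + e for suitable s >= 0; hence x = y (1 + y)^-1
    exists, lies in F_A and generates the same ideal as y, and countably many
    such x, chosen along a dense sequence of J, are combined into one by the
    second claim. *)

(** * Sublinear functionals and the complex Hahn-Banach theorem *)

Section HahnBanach.
Variables (R : realType) (V : lmodType R[i]).
Implicit Types (p q : V -> R) (u v : V).

Definition sublinear p : Prop :=
  (forall u v, p (u + v) <= p u + p v) /\
  (forall t v, 0 <= t -> p (t%:C *: v) = t * p v).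

Lemma sublinear0 p : sublinear p -> p 0 = 0.
Proof. by move=> [_ /(_ 0 0 (lexx _))]; rewrite scaler0 mul0r. Qed.

Lemma sublinear_oppr p v : sublinear p -> - p (- v) <= p v.
Proof.
move=> sp; have := sp.1 v (- v); rewrite subrr sublinear0//.
by rewrite -subr_le0 sub0r opprD addrC; lra.
Qed.

(** Serves three infima: tilts, infima of chains, and one-sided derivatives of the norm. Homogeneity
    is asked only as an inequality for [0 < t]; applying it to [t^-1] gives the reverse one. *)
Lemma inf_sublinear (S : V -> set R) :
  (forall v, S v !=set0) -> (forall v, has_lbound (S v)) ->
  (forall u v x y, S u x -> S v y -> exists2 z, S (u + v) z & z <= x + y) ->
  (forall t v x, 0 < t -> S v x -> exists2 z, S (t%:C *: v) z & z <= t * x) ->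
  sublinear (fun v => inf (S v)).
Proof.
move=> S0 Slb SD SZ.
have infZ t v : 0 < t -> inf (S (t%:C *: v)) <= t * inf (S v).
  move=> t0; rewrite -ler_pdivrMl//; apply: lb_le_inf => // x Sx.
  have [z Sz zx] := SZ t v x t0 Sx; rewrite ler_pdivrMl//.
  by apply: le_trans zx; exact: ge_inf.
split=> [u v|t v].
- rewrite -lerBlDr; apply: lb_le_inf => // x Sx.
  rewrite lerBlDr -lerBlDl; apply: lb_le_inf => // y Sy.
  have [z Sz zxy] := SD u v x y Sx Sy; rewrite lerBlDl.
  by apply: le_trans zxy; exact: ge_inf.
rewrite le_eqVlt => /predU1P[<-|t0].
  (* With m the infimum at 0, the factors 2 and 1/2 give m <= 2m and m <= m/2, hence m = 0. *)
  have := infZ 2 0; have := infZ 2^-1 0.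
  by rewrite !scaler0 scale0r mul0r invr_gt0 ltr0n => /(_ isT) ? /(_ isT) ?; lra.
apply/eqP; rewrite eq_le infZ//= -ler_pdivlMl//.
have := infZ t^-1 (t%:C *: v).
by rewrite invr_gt0 scalerA -rmorphM/= mulVf ?gt_eqF// scale1r => /(_ t0).
Qed.

(** For sublinear [p], this is the largest sublinear functional below [p] whose value at [- u] is at
    most [- p u]. *)
Definition tilt p u v : R :=
  inf [set p (v + t%:C *: u) - t * p u | t in [set t | 0 <= t]].

Lemma tilt_lbound p u v : sublinear p ->
  lbound [set p (v + t%:C *: u) - t * p u | t in [set t | 0 <= t]] (- p (- v)).
Proof.
move=> [pD pZ] _ [t /= t0 <-].
by have := pD (v + t%:C *: u) (- v); rewrite addrAC subrr add0r pZ//; lra.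
Qed.

Lemma tilt_le p u v t : sublinear p -> 0 <= t ->
  tilt p u v <= p (v + t%:C *: u) - t * p u.
Proof.
move=> sp t0; apply: ge_inf; last by exists t.
by eexists; exact: tilt_lbound.
Qed.

Lemma tilt_id_le p u v : sublinear p -> tilt p u v <= p v.
Proof.
by move=> sp; have := tilt_le u v sp (lexx 0); rewrite scale0r addr0 mul0r subr0.
Qed.

Lemma tiltN_le p u : sublinear p -> tilt p u (- u) <= - p u.
Proof.
move=> sp; have := tilt_le u (- u) sp ler01.
by rewrite scale1r addNr sublinear0// mul1r sub0r.
Qed.

Lemma sublinear_tilt p u : sublinear p -> sublinear (tilt p u).
Proof.
move=> sp; pose S v := [set p (v + t%:C *: u) - t * p u | t in [set t | 0 <= t]].
apply: (@inf_sublinear S).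
- by move=> v; exists (p (v + 0%:C *: u) - 0 * p u); exists 0; [exact: lexx|].
- by move=> v; eexists; exact: tilt_lbound.
- move=> v w _ _ [s /= s0 <-] [t /= t0 <-].
  exists (p (v + w + (s + t)%:C *: u) - (s + t) * p u).
    by exists (s + t) => //=; exact: addr_ge0.
  have := sp.1 (v + s%:C *: u) (w + t%:C *: u).
  by rewrite addrACA -scalerDl -rmorphD/=; lra.
- move=> t v _ t0 [s /= s0 <-].
  exists (p (t%:C *: v + (t * s)%:C *: u) - (t * s) * p u).
    by exists (t * s) => //=; apply: mulr_ge0 => //; exact: ltW.
  by rewrite rmorphM/= -scalerA -scalerDr sp.2 ?(ltW t0)// mulrBr mulrA.
Qed.

(* A minimal sublinear functional q coincides with each of its tilts, so that
   q (- u) <= - q u for every u. *)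
Lemma sublinear_minorant p : sublinear p ->
  exists q, [/\ sublinear q, (forall v, q v <= p v) & forall v, q (- v) = - q v].
Proof.
move=> sp; pose T := {q : V -> R | sublinear q /\ forall v, q v <= p v}.
pose t0 : T := exist _ p (conj sp (fun v => lexx _)).
(* The order is reversed, so that a maximal element for Zorn's lemma is pointwise minimal. *)
pose le (f g : T) := `[< forall v, sval g v <= sval f v >].
have [| |F Ftot|[q [sq qp]] qmin] := @ZL_preorder T t0 le.
- by move=> f; apply/asboolP.
- move=> f g h /asboolP fg /asboolP gh; apply/asboolP => v.
  exact: le_trans (gh v) (fg v).
- have [->|/set0P[f0 Ff0]] := eqVneq F set0; first by exists t0.
  pose S v := [set sval f v | f in F].
  have Slb v : lbound (S v) (- p (- v)).
    move=> _ [[g [sg gp]] _ <-] /=.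
    by apply: le_trans (sublinear_oppr v sg); rewrite lerN2.
  have Sinf f v : F f -> inf (S v) <= sval f v.
    by move=> Ff; apply: ge_inf; [exists (- p (- v)) | exists f].
  have sS : sublinear (fun v => inf (S v)).
    apply: inf_sublinear.
    + by move=> v; exists (sval f0 v); exists f0.
    + by move=> v; exists (- p (- v)).
    + move=> u v _ _ [f Ff <-] [g Fg <-].
      (* The smaller of the two members of the chain serves for both arguments. *)
      have [/asboolP fg|/asboolP gf] := Ftot _ _ Ff Fg.
        exists (sval g (u + v)); first by exists g.
        by apply: le_trans ((svalP g).1.1 u v) _; rewrite lerD2r.
      exists (sval f (u + v)); first by exists f.
      by apply: le_trans ((svalP f).1.1 u v) _; rewrite lerD2l.
    + move=> t v _ t1 [f Ff <-]; exists (sval f (t%:C *: v)); first by exists f.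
      by rewrite (svalP f).1.2// ltW.
  have Sp v : inf (S v) <= p v by apply: le_trans (Sinf f0 v Ff0) ((svalP f0).2 v).
  exists (exist _ (fun v => inf (S v)) (conj sS Sp)) => f Ff.
  by apply/asboolP => v /=; exact: Sinf.
exists q; split=> // u.
have tp v : tilt q u v <= p v by apply: le_trans (qp v); exact: tilt_id_le.
pose tq : T := exist _ (tilt q u) (conj (sublinear_tilt u sq) tp).
have /asboolP qt : le tq (exist _ q (conj sq qp)).
  by apply: qmin; apply/asboolP => v /=; exact: tilt_id_le.
apply/eqP; rewrite eq_le (le_trans (qt (- u)) (tiltN_le u sq))/=.
by rewrite lerNl; exact: sublinear_oppr.
Qed.

(* The real-linear functional f extends to v |-> f v - i f (i v). *)
Theorem hahn_banach p u : sublinear p ->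
  exists f : V -> R[i],
    [/\ forall v w, f (v + w) = f v + f w, forall k v, f (k *: v) = k * f v,
        forall v, Re (f v) <= p v & Re (f u) = p u].
Proof.
(* Minorizing the tilt instead of [p] forces [g (- u) <= - p u], hence [g u = p u]. *)
move=> sp; have [g [[gD gZ] gt gN]] := sublinear_minorant (sublinear_tilt u sp).
have gB v w : g (v + w) = g v + g w.
  apply/eqP; rewrite eq_le gD/=.
  by have := gD (- v) (- w); rewrite -opprD !gN; lra.
have gZr (t : R) v : g (t%:C *: v) = t * g v.
  have [t0|t0] := leP 0 t; first exact: gZ.
  rewrite -[t]opprK rmorphN/= scaleNr gN gZ ?mulNr// oppr_ge0; exact: ltW.
exists (fun v => g v +i* - g ('i%C *: v)); split=> /=.
- by move=> v w; rewrite scalerDr !gB opprD.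
- move=> [a b] v.
  have E (w : V) : (a +i* b) *: w = a%:C *: w + b%:C *: ('i%C *: w).
    by rewrite scalerA -scalerDl; congr (_ *: _); simpc.
  have ii (w : V) : 'i%C *: ('i%C *: w) = - w.
    by rewrite scalerA -expr2 sqr_i scaleN1r.
  have iC (t : R) (w : V) : 'i%C *: (t%:C *: w) = t%:C *: ('i%C *: w).
    by rewrite !scalerA mulrC.
  by rewrite !E scalerDr !iC ii !gB !gZr gN; simpc; congr (_ +i* _); ring.
- by move=> v; apply: le_trans (gt v) (tilt_id_le _ _ sp).
- apply/eqP; rewrite eq_le (le_trans (gt u) (tilt_id_le _ _ sp))/=.
  by have := le_trans (gt (- u)) (tiltN_le _ sp); rewrite gN lerN2.
Qed.

End HahnBanach.

(** * The norm as a real number; closures, limits and geometric convergence *)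

Section RealNorm.
Variables (R : realType) (V : normedModType R[i]).
Implicit Types (u v w : V) (r t : R).

(* The norm of V takes its values in R[i]; nr is the same norm, valued in R. *)
Definition nr v : R := Re `|v|.

Lemma nrE v : `|v| = (nr v)%:C.
Proof. by rewrite RRe_real ?normr_real. Qed.

Lemma ler_nr v r : (`|v| <= r%:C) = (nr v <= r).
Proof. by rewrite nrE lecR. Qed.

Lemma ltr_nr v r : (`|v| < r%:C) = (nr v < r).
Proof. by rewrite nrE ltcR. Qed.

Lemma nr_ge0 v : 0 <= nr v.
Proof. by rewrite -lecR -nrE normr_ge0. Qed.

Lemma ler_nrD v w : nr (v + w) <= nr v + nr w.
Proof. by rewrite -ler_nr rmorphD/= -!nrE ler_normD. Qed.

Lemma nrN v : nr (- v) = nr v.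
Proof. by rewrite /nr normrN. Qed.

Lemma nr_distC v w : nr (v - w) = nr (w - v).
Proof. by rewrite -nrN opprB. Qed.

Lemma ler_nrB v w : nr (v - w) <= nr v + nr w.
Proof. by rewrite -(nrN w) ler_nrD. Qed.

Lemma ler_nr_distD u v w : nr (v - w) <= nr (v - u) + nr (u - w).
Proof. by have := ler_nrD (v - u) (u - w); rewrite addrA subrK. Qed.

Lemma nr0 : nr 0 = 0.
Proof. by rewrite /nr normr0. Qed.

Lemma nr_gt0 v : (0 < nr v) = (v != 0).
Proof. by rewrite -ltcR -nrE normr_gt0. Qed.

Lemma nrZ t v : nr (t%:C *: v) = `|t| * nr v.
Proof.
apply: complexI; rewrite rmorphM/= -!nrE normrZ; congr (_ * _).
by rewrite normc_def/= expr0n/= addr0 sqrtr_sqr.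
Qed.

Lemma nrZ_ge0 t v : 0 <= t -> nr (t%:C *: v) = t * nr v.
Proof. by move=> t0; rewrite nrZ ger0_norm. Qed.

Lemma lt0c_real (e : R[i]) : 0 < e -> exists2 r, 0 < r & e = r%:C.
Proof.
move=> e0; exists (Re e); last by rewrite RRe_real// gtr0_real.
by rewrite -ltcR RRe_real// gtr0_real.
Qed.

Lemma closure_nrP (S : set V) v :
  closure S v <-> forall e, 0 < e -> exists2 w, S w & nr (v - w) < e.
Proof.
split=> [Sv e e0|H B /nbhs_ballP[_/= /lt0c_real[e e0 ->] eB]].
  have [|w [Sw]] := Sv (ball v e%:C); first by apply: nbhsx_ballx; rewrite ltcR.
  by rewrite -ball_normE/= ltr_nr; exists w.
have [w Sw vw] := H e e0; exists w; split => //; apply: eB.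
by rewrite -ball_normE/= ltr_nr.
Qed.

Lemma cvg_nrP (u : nat -> V) v : u @ \oo --> v <->
  forall e, 0 < e -> exists N, forall n, (N <= n)%N -> nr (v - u n) < e.
Proof.
split=> [/cvgrPdist_lt uv e e0|H].
  have [|N _ uN] := uv e%:C; first by rewrite ltcR.
  by exists N => n Nn; rewrite -ltr_nr; exact: uN.
apply/cvgrPdist_lt => _ /lt0c_real[e e0 ->]; have [N uN] := H e e0.
by exists N => // n /= Nn; rewrite ltr_nr; exact: uN.
Qed.

End RealNorm.

Lemma ler_addgtMP (R : realType) (a b c : R) :
  (forall e, 0 < e -> a <= b + e * c) -> a <= b.
Proof.
move=> H; apply/ler_addgt0Pr => e e0.
have d : 0 < 1 + `|c| by rewrite ltr_pwDl.
have := H (e / (1 + `|c|)); rewrite divr_gt0// => /(_ isT) /le_trans; apply.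
rewrite lerD2l mulrAC ler_pdivrMr// ler_wpM2l//; first exact: ltW.
by have := ler_norm c; lra.
Qed.

Lemma geometric_cvg (R : realType) (V : completeNormedModType R[i]) (u : nat -> V)
    (C q : R) :
  0 <= q < 1 -> (forall n, nr (u n.+1 - u n) <= C * q ^+ n) ->
  exists v : V, u @ \oo --> v.
Proof.
move=> /andP[q0 q1] uq.
have C0 : 0 <= C by have := le_trans (nr_ge0 _) (uq 0); rewrite mulr1.
have d0 : 0 < 1 - q by lra.
(* The exact geometric sum is kept so that the induction closes; its negative term is dropped
   afterwards. *)
have ud n k : nr (u (n + k)%N - u n) <= C / (1 - q) * (q ^+ n - q ^+ (n + k)).
  elim: k => [|k IH]; first by rewrite addn0 !subrr nr0 mulr0.
  apply: le_trans (ler_nr_distD (u (n + k)%N) _ _) _; rewrite addnS.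
  apply: le_trans (lerD (uq _) IH) _; rewrite exprS le_eqVlt; apply/orP; left.
  by apply/eqP; field; rewrite gt_eqF.
have {}ud n k : nr (u (n + k)%N - u n) <= C / (1 - q) * q ^+ n.
  apply: le_trans (ud n k) _; apply: ler_wpM2l; first by rewrite divr_ge0// ltW.
  by rewrite gerBl exprn_ge0.
have qe (e : R) : 0 < e -> exists N, C / (1 - q) * q ^+ N < e.
  move=> e0; have q1' : `|q| < 1 by rewrite ger0_norm.
  have /cvgrPdist_lt/(_ e e0)[N _ /(_ N (leqnn N))] := cvg_geometric (C / (1 - q)) q1'.
  by rewrite sub0r normrN => /= /(le_lt_trans (ler_norm _)); exists N.
suff : cvg (u @ \oo) by move=> ?; exists (lim (u @ \oo)).
apply/cauchy_cvgP/cauchy_exP => _ /lt0c_real[e e0 ->].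
have [N NE] := qe e e0; exists (u N), N => // n /= /subnKC <-.
by rewrite -ball_normE/= ltr_nr nr_distC; apply: le_lt_trans (ud _ _) NE.
Qed.

(** * The algebraic unitization as a commutative ring *)

Section Unitization.
Variables (R : realType) (A : completeNormedModType R[i]) (mul : A -> A -> A).
Hypothesis Amul : comm_banach_alg mul.

Lemma cmulA a b c : mul a (mul b c) = mul (mul a b) c.
Proof. by case: Amul. Qed.

Lemma cmulC a b : mul a b = mul b a.
Proof. by case: Amul => _ []. Qed.

Lemma cmulDl a b c : mul (a + b) c = mul a c + mul b c.
Proof. by case: Amul => _ [_ []]. Qed.

Lemma cmulZl k a b : mul (k *: a) b = k *: mul a b.
Proof. by case: Amul => _ [_ [_ [_ []]]]. Qed.

Lemma cmulDr a b c : mul a (b + c) = mul a b + mul a c.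
Proof. by rewrite !(cmulC a) cmulDl. Qed.

Lemma cmulZr k a b : mul a (k *: b) = k *: mul a b.
Proof. by rewrite !(cmulC a) cmulZl. Qed.

(** The proof of the algebra axioms is a parameter of the type because the ring structure attached
    to it depends on that proof. *)
Definition unitization of comm_banach_alg mul : Type := (A * R[i])%type.
Local Notation U := (unitization Amul).
HB.instance Definition _ := GRing.Zmodule.copy U (A * R[i])%type.

Definition unitization_one : U := (0, 1).
Definition unitization_mul (u v : U) : U :=
  (mul u.1 v.1 + u.2 *: v.1 + v.2 *: u.1, u.2 * v.2).

Lemma unitization_mulC : commutative unitization_mul.
Proof.
by move=> u v; rewrite /unitization_mul cmulC mulrC addrAC.
Qed.

Lemma unitization_mul1 : left_id unitization_one unitization_mul.
Proof.
case=> a k; rewrite /unitization_mul /= -(scale0r 0) cmulZl !scale0r.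
by rewrite scale1r scaler0 add0r addr0 mul1r.
Qed.

Lemma unitization_mulDl : left_distributive unitization_mul +%R.
Proof.
case=> a k [b l] [c m]; congr (_, _) => /=; last by rewrite mulrDl.
by rewrite cmulDl scalerDl scalerDr (addrACA (mul a c)) (addrACA (_ + k *: c)).
Qed.

Lemma unitization_mulA : associative unitization_mul.
Proof.
case=> a k [b l] [c m]; congr (_, _) => /=; last by rewrite mulrA.
rewrite !(cmulDl, cmulDr, cmulZl, cmulZr, scalerDr, scalerA) cmulA.
rewrite -!addrA (mulrC m k) (mulrC m l); congr (_ + _).
by rewrite [RHS]addrCA; congr (_ + _); rewrite addrCA; congr (_ + _); rewrite addrCA.
Qed.

Lemma unitization_oneN0 : unitization_one != 0.
Proof. by apply/eqP => -[/eqP]; rewrite oner_eq0. Qed.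

HB.instance Definition _ := GRing.Zmodule_isComNzRing.Build U
  unitization_mulA unitization_mulC unitization_mul1 unitization_mulDl
  unitization_oneN0.

Definition unit_inj (a : A) : U := (a, 0).
Definition unit_scal (k : R[i]) : U := (0, k).

Lemma unit_inj_additive : additive unit_inj.
Proof. by move=> a b; congr (_, _) => /=; rewrite subr0. Qed.
HB.instance Definition _ := GRing.isAdditive.Build A U unit_inj unit_inj_additive.

Lemma unit_scal_additive : additive unit_scal.
Proof. by move=> a b; congr (_, _) => /=; rewrite subr0. Qed.
HB.instance Definition _ :=
  GRing.isAdditive.Build R[i] U unit_scal unit_scal_additive.

Lemma unit_scal_multiplicative : multiplicative unit_scal.
Proof.
split=> // k l; congr (_, _) => /=.
by rewrite -[X in mul X](scale0r 0) cmulZl scale0r !scaler0 !addr0.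
Qed.
HB.instance Definition _ :=
  GRing.isMultiplicative.Build R[i] U unit_scal unit_scal_multiplicative.

Lemma unit_injM a b : unit_inj (mul a b) = unit_inj a * unit_inj b.
Proof. by congr (_, _) => /=; rewrite ?scale0r ?addr0 ?mul0r. Qed.

Lemma unit_injZ k a : unit_inj (k *: a) = unit_scal k * unit_inj a.
Proof.
congr (_, _) => /=; last by rewrite mulr0.
by rewrite -[X in mul X](scale0r 0) cmulZl !scale0r add0r addr0.
Qed.

Lemma unit_inj_inj : injective unit_inj.
Proof. by move=> a b []. Qed.

Lemma unit_injD a b : unit_inj (a + b) = unit_inj a + unit_inj b.
Proof. exact: raddfD. Qed.

Lemma unit_injN a : unit_inj (- a) = - unit_inj a.
Proof. exact: raddfN. Qed.

End Unitization.

(* Identities in A are checked in its unitization, a commutative ring in which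
   the scalars of R[i] are the values of a ring morphism. *)
Ltac unitization_ring :=
  match goal with H : comm_banach_alg _ |- _ =>
    apply: (unit_inj_inj (Amul := H))
  end;
  rewrite !(unit_injD, unit_injN, unit_injM, unit_injZ); ring.

(** * The ideal generated by a sum of two elements [p], [q] with 1 - p and 1 - q contractive *)

Section SumGenerates.
Variables (R : realType) (A : completeNormedModType R[i]) (mul : A -> A -> A).
Hypothesis Amul : comm_banach_alg mul.
Implicit Types (a b c p q x y z : A).

Lemma nrM a b : nr (mul a b) <= nr a * nr b.
Proof.
rewrite -ler_nr rmorphM/= -!nrE.
by case: Amul => _ [_ [_ [_ [_ [_]]]]].
Qed.

Lemma cmulBr a b c : mul a (b - c) = mul a b - mul a c.
Proof. by unitization_ring. Qed.

Lemma nrM_dist x a b : nr (mul x a - mul x b) <= nr x * nr (a - b).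
Proof. by rewrite -cmulBr nrM. Qed.

Definition contractive1 p := forall c, nr (c - mul p c) <= nr c.

Lemma contractive1_convex p q t : 0 <= t <= 1 ->
  contractive1 p -> contractive1 q ->
  contractive1 (t%:C *: p + (1 - t)%:C *: q).
Proof.
move=> /andP[t0 t1] cp cq c.
have -> : c - mul (t%:C *: p + (1 - t)%:C *: q) c =
    t%:C *: (c - mul p c) + (1 - t)%:C *: (c - mul q c) by unitization_ring.
apply: le_trans (ler_nrD _ _) _; rewrite !nrZ_ge0 ?subr_ge0//.
have := ler_wpM2l t0 (cp c).
have : (1 - t) * nr (c - mul q c) <= (1 - t) * nr c.
  by apply: ler_wpM2l (cq c); rewrite subr_ge0.
lra.
Qed.

(* Modulo (p + q)A the contractions P = 1 - p and Q = 1 - q satisfy P + Q = 2,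
   so v(N, a) = N (P - Q) c + 2 a c obeys
     2 v(N + 1, a) = P v(N, a + 1) + Q v(N, a - 1).
   Hence |v(N, a)| <= 2 |c| E|a + S_N| for the simple random walk S_N, and this
   mean is estimated by 2 M |s| <= s^2 + M^2 and E (a + S_N)^2 = a^2 + N. *)
Lemma random_walk_bound p q c (M : R) : 0 < M ->
  contractive1 p -> contractive1 q ->
  forall (N : nat) (a : R), exists w,
    nr ((N%:R)%:C *: mul (q - p) c + (2 * a)%:C *: c - mul (p + q) w)
      <= (N%:R + a ^+ 2 + M ^+ 2) / M * nr c.
Proof.
move=> M0 cp cq; elim=> [|N IH] a.
  exists 0.
  have -> : (0%:R)%:C *: mul (q - p) c + (2 * a)%:C *: c - mul (p + q) 0 =
    (2 * a)%:C *: c.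
    by rewrite scale0r add0r -(scale0r 0) (cmulZr Amul) scale0r subr0.
  rewrite nrZ; apply: ler_wpM2r; first exact: nr_ge0.
  rewrite ler_pdivlMr// normrM ger0_norm// -(real_normK (num_real a)).
  by have := sqr_ge0 (`|a| - M); rewrite sqrrB; lra.
have [w1] := IH (a + 1); have [w2] := IH (a - 1).
set u2 := _ - mul (p + q) w2; set u1 := _ - mul (p + q) w1 => u2M u1M.
(* The witness halves all that is multiplied by [p + q] in P u1 + Q u2: the terms P w1 and Q w2, and
   the term left by P + Q = 2 - (p + q) acting on [N (q - p) c + 2 a c]. *)
exists (2^-1%:C *: (w1 + w2 + (N%:R)%:C *: mul (q - p) c + (2 * a)%:C *: c
                   - mul p w1 - mul q w2)).
set v := nr (_ - _).
suff : 2 * v <= nr (u1 - mul p u1) + nr (u2 - mul q u2).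
  have := cp u1; have := cq u2; rewrite -(natr1 N).
  have -> : (N%:R + 1 + a ^+ 2 + M ^+ 2) / M * nr c =
    2^-1 * ((N%:R + (a + 1) ^+ 2 + M ^+ 2) / M * nr c +
    (N%:R + (a - 1) ^+ 2 + M ^+ 2) / M * nr c) by field; rewrite gt_eqF.
  by lra.
apply: le_trans (ler_nrD _ _); rewrite -nrZ_ge0//.
rewrite le_eqVlt; apply/orP; left; apply/eqP; congr nr.
have half x : 2%:C *: mul (p + q) (2^-1%:C *: x) = mul (p + q) x.
  by rewrite -(cmulZr Amul) scalerA -rmorphM/= mulfV// scale1r.
rewrite -(natr1 N) scalerBr half /u1 /u2.
unitization_ring.
Qed.

(** A walk of n^2 steps from 0, with M = n, puts n^2 (q - p) c within 2 n |c| of (p + q)A. Dividing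
    by 2 n^2 and using p c = ((p + q) c - (q - p) c) / 2 puts p c within |c| / n of it. *)
Lemma sum_generates p q c : contractive1 p -> contractive1 q ->
  cl_xA mul (p + q) (mul p c).
Proof.
move=> cp cq; apply/closure_nrP => e e0.
pose n := (Num.truncn (nr c / e)).+1.
have ne : nr c / e < n%:R by apply: truncnS_gt.
have n0 : 0 < n%:R :> R by rewrite ltr0n.
have [w] := random_walk_bound c n0 cp cq (n ^ 2) 0.
rewrite mulr0 scale0r addr0 expr0n/= addr0 natrX.
set m : R := n%:R in n0 ne *; set d := _ - _ => dM.
pose k : R := (2 * m ^+ 2)^-1.
have k0 : 0 <= k by rewrite invr_ge0 mulr_ge0// sqr_ge0.
exists (mul (p + q) ((k * m ^+ 2)%:C *: c - k%:C *: w)); first by eexists.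
have -> : mul p c - mul (p + q) ((k * m ^+ 2)%:C *: c - k%:C *: w) = k%:C *: - d.
  have -> : mul p c = (2 * k * m ^+ 2)%:C *: mul p c.
    rewrite -[LHS]scale1r; congr (_ *: _); rewrite /k; congr (_ +i* _).
    by field; rewrite gt_eqF.
  rewrite /d; unitization_ring.
rewrite nrZ_ge0// nrN.
apply: (@le_lt_trans _ _ (k * ((m ^+ 2 + m ^+ 2) / m * nr c))).
  exact: ler_wpM2l.
rewrite /k; move: ne; rewrite !ltr_pdivrMr// => ne.
have -> : (2 * m ^+ 2)^-1 * ((m ^+ 2 + m ^+ 2) / m * nr c) = nr c / m.
  by field; rewrite gt_eqF.
by rewrite ltr_pdivrMr// mulrC.
Qed.

End SumGenerates.

(** * Elements of F_A and their dyadic series *)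

Section Contractive.
Variables (R : realType) (A : completeNormedModType R[i]) (mul : A -> A -> A).
Hypothesis Amul : comm_banach_alg mul.
Implicit Types (a b c p q x y z : A).

Lemma cmul0l c : mul 0 c = 0.
Proof. by rewrite -[in LHS](scale0r 0) (cmulZl Amul) scale0r. Qed.

Lemma cmul0r c : mul c 0 = 0.
Proof. by rewrite (cmulC Amul) cmul0l. Qed.

Lemma mnorm_leP a k (r : R) : 0 <= r ->
  mnorm_le mul a k r%:C <-> forall c, nr (mul a c + k *: c) <= r * nr c.
Proof.
move=> r0; split=> [H c|H c c1].
  have [->|c0] := eqVneq c 0; first by rewrite cmul0r scaler0 addr0 nr0 mulr0.
  have nc : 0 < nr c by rewrite nr_gt0.
  have := H ((nr c)^-1%:C *: c).
  rewrite ler_nr nrE nrZ_ge0 ?invr_ge0 ?nr_ge0// mulVf ?gt_eqF// lexx => /(_ isT).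
  rewrite (cmulZr Amul) scalerA mulrC -scalerA -scalerDr nrZ_ge0 ?invr_ge0 ?nr_ge0//.
  by rewrite lecR ler_pdivrMl// [leRHS]mulrC.
rewrite ler_nr; apply: le_trans (H c) _; rewrite -[leRHS]mulr1 ler_wpM2l//.
by rewrite -ler_nr.
Qed.

(** Removes the case distinction on a unit. If [e] is one, submultiplicativity gives one direction
    and evaluation at [e] the other. *)
Lemma in_FA_contractive1 x : in_FA mul x <-> contractive1 mul x.
Proof.
have mP : mnorm_le mul (- x) 1 1 <-> contractive1 mul x.
  have -> : 1 = 1%:C :> R[i] by [].
  rewrite mnorm_leP ?ler01//.
  have E c : mul (- x) c + 1%:C *: c = c - mul x c by unitization_ring.
  by split=> H c; have := H c; rewrite mul1r E.
split=> [[[e [[eid e1] ex]]|[_ /mP//]]|cx].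
  move=> c; have -> : c - mul x c = mul (e - x) c.
    by rewrite -{1}(eid c).1; unitization_ring.
  apply: le_trans (nrM Amul _ _) _; rewrite -[leRHS]mul1r ler_wpM2r ?nr_ge0//.
  by rewrite -ler_nr.
have [[e [eid e1]]|nu] := pselect (unital mul); last by right; split=> //; exact/mP.
left; exists e; split=> //.
have := cx e; rewrite -ler_nr -nrE e1.
by rewrite (eid x).2.
Qed.

(** Along the contractive approximate identity, |x u_i| <= |u_i - x u_i| + |u_i| <= 2, and x u_i
    tends to x. *)
Lemma contractive1_nr x : approx_unital mul -> contractive1 mul x -> nr x <= 2.
Proof.
move=> [I [le [u [[_ lexx _ _] u1 ua]]]] cx.
apply/ler_addgt0Pr => e e0.
have [|i /(_ i (lexx i))] := (ua x).2 e%:C; first by rewrite ltcR.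
rewrite ltr_nr nr_distC => xi.
have ui1 : nr (u i) <= 1 by rewrite -ler_nr.
have := ler_nr_distD (mul x (u i)) x 0; rewrite !subr0.
have := ler_nr_distD (u i) (mul x (u i)) 0; rewrite !subr0 nr_distC.
by have := cx (u i); lra.
Qed.

Lemma cl_xAZ x (k : R[i]) : cl_xA mul (k *: x) `<=` cl_xA mul x.
Proof.
apply: closureS => _ [c _ <-]; exists (k *: c) => //.
by rewrite (cmulZl Amul) (cmulZr Amul).
Qed.

Lemma cl_xA_mem x c : cl_xA mul x (mul x c).
Proof. by apply: subset_closure; exists c. Qed.

Lemma cl_xAD x a b : cl_xA mul x a -> cl_xA mul x b -> cl_xA mul x (a + b).
Proof.
move=> /closure_nrP xa /closure_nrP xb; apply/closure_nrP => e e0.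
have e2 : 0 < e / 2 by rewrite divr_gt0.
have [_ [c _ <-] ac] := xa _ e2; have [_ [d _ <-] bd] := xb _ e2.
exists (mul x (c + d)); first by exists (c + d).
have -> : a + b - mul x (c + d) = (a - mul x c) + (b - mul x d) by unitization_ring.
by apply: le_lt_trans (ler_nrD _ _) _; lra.
Qed.

Lemma cl_xA0 x : cl_xA mul x 0.
Proof. by rewrite -(cmul0r x); exact: cl_xA_mem. Qed.

(** The weights are not normalized and [P] may drop an index, so that a partial sum without its k-th
    term is covered. *)
Lemma contractive1_sum (P : pred nat) (w : nat -> R) (x : nat -> A) m n :
  (forall k, 0 <= w k) -> (forall k, (m <= k)%N -> contractive1 mul (x k)) ->
  forall c, nr ((\sum_(m <= k < n | P k) w k)%:C *: c
                 - mul (\sum_(m <= k < n | P k) (w k)%:C *: x k) c)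
     <= (\sum_(m <= k < n | P k) w k) * nr c.
Proof.
move=> w0 cx c; rewrite big_nat_cond [X in mul X]big_nat_cond.
elim/big_ind2: _ => [|y s y' s' IH IH'|k /andP[/andP[mk _] _]].
- by rewrite cmul0l scale0r subr0 nr0 mul0r.
- have -> : (s + s')%:C *: c - mul (y + y') c =
    (s%:C *: c - mul y c) + (s'%:C *: c - mul y' c) by unitization_ring.
  by rewrite mulrDl; apply: le_trans (ler_nrD _ _) _; exact: lerD.
- by rewrite (cmulZl Amul) -scalerBr nrZ_ge0// ler_wpM2l// cx.
Qed.

Lemma half_sum n : \sum_(1 <= k < n.+1) (2 ^- k : R) = 1 - 2 ^- n.
Proof.
elim: n => [|n IH]; first by rewrite big_nil expr0 invr1 subrr.
rewrite big_nat_recr//= IH exprS; field.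
by rewrite expf_neq0.
Qed.

Section HalfSeries.
Variable x : nat -> A.
Hypothesis Aau : approx_unital mul.
Hypothesis xF : forall k, (1 <= k)%N -> contractive1 mul (x k).
Let S n := \sum_(1 <= k < n.+1) (2 ^- k : R)%:C *: x k.

Lemma half_series_cvg : exists z : A, S @ \oo --> z.
Proof.
apply: (@geometric_cvg _ _ _ 1 2^-1); first by apply/andP; split; lra.
move=> n; rewrite /S big_nat_recr//= addrAC subrr add0r nrZ_ge0.
  have := contractive1_nr Aau (xF (ltn0Sn n)).
  rewrite exprS invfM mul1r mulrAC -exprVn => ?.
  by rewrite ler_piMl ?exprn_ge0//; lra.
by rewrite invr_ge0 exprn_ge0.
Qed.

Lemma half_series_remainder z k c : S @ \oo --> z -> (1 <= k)%N ->
  nr ((1 - 2 ^- k : R)%:C *: c - mul (z - (2 ^- k : R)%:C *: x k) c)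
    <= (1 - 2 ^- k) * nr c.
Proof.
move=> /cvg_nrP Sz k1; apply: (@ler_addgtMP _ _ _ (nr c)) => e e0.
have [N /(_ (maxn N k) (leq_maxl _ _))] := Sz e e0.
set n := maxn N k; have kn : (k <= n)%N by exact: leq_maxr.
have w0 j : 0 <= 2 ^- j :> R by rewrite invr_ge0 exprn_ge0.
have := contractive1_sum (fun j => j != k) n.+1 w0 xF c.
have kin : k \in index_iota 1 n.+1 by rewrite mem_index_iota k1.
have := half_sum n; rewrite (bigD1_seq k) ?iota_uniq//=.
have : S n = _ := erefl; rewrite {2}/S (bigD1_seq k) ?iota_uniq//=.
set y := \sum_(1 <= j < n.+1 | _) _; set s := \sum_(1 <= j < n.+1 | _) _.
move=> Sn sn Hc zS.
(* The remaining weights sum to [s = 1 - 2 ^- n - 2 ^- k]; the missing mass [2 ^- n] is put back as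
   a multiple of [c]. *)
have -> : (1 - 2 ^- k : R)%:C *: c - mul (z - (2 ^- k : R)%:C *: x k) c =
  (s%:C *: c - mul y c) + (2 ^- n : R)%:C *: c + mul (S n - z) c.
  have -> : (1 - 2 ^- k : R) = s + 2 ^- n by lra.
  by rewrite Sn; unitization_ring.
apply: le_trans (ler_nrD _ _) _; rewrite lerD//; last first.
  apply: le_trans (nrM Amul _ _) _; rewrite ler_wpM2r ?nr_ge0// nr_distC; exact: ltW.
apply: le_trans (ler_nrD _ _) _; rewrite nrZ_ge0//.
have -> : (1 - 2 ^- k : R) = s + 2 ^- n by lra.
by rewrite mulrDl lerD2r.
Qed.

Lemma half_series_split z k : S @ \oo --> z -> (1 <= k)%N ->
  exists2 y, contractive1 mul y &
    z = (2 ^- k : R)%:C *: x k + (1 - 2 ^- k : R)%:C *: y.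
Proof.
move=> Sz k1; pose t : R := 2 ^- k.
have t1 : 0 < 1 - t.
  by rewrite subr_gt0 invf_lt1 ?exprn_gt0// exprn_egt1 -?lt0n ?ltr1n//.
exists ((1 - t)^-1%:C *: (z - t%:C *: x k)); last first.
  rewrite scalerA -rmorphM/= mulfV ?gt_eqF// scale1r.
  by rewrite addrC subrK.
move=> c; have := half_series_remainder c Sz k1; rewrite -/t.
have -> : c - mul ((1 - t)^-1%:C *: (z - t%:C *: x k)) c =
  (1 - t)^-1%:C *: ((1 - t)%:C *: c - mul (z - t%:C *: x k) c).
  rewrite [RHS]scalerBr scalerA -rmorphM/= mulVf ?gt_eqF// scale1r.
  by rewrite (cmulZl Amul).
by rewrite nrZ_ge0 ?invr_ge0 ?(ltW t1)// ler_pdivrMl.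
Qed.

Lemma half_series_contractive1 z : S @ \oo --> z -> contractive1 mul z.
Proof.
move=> Sz; have [y cy ->] := half_series_split Sz (leqnn 1).
apply: contractive1_convex => //; last exact: xF.
by apply/andP; rewrite expr1; split; lra.
Qed.

(** With t = 2^-k and z = t x_k + (1 - t) y, put p = 2t x_k + (1 - 2t) y, a convex combination since
    k >= 1. Then p + y = 2z, so pA and yA lie in the closure of zA, and x_k is a linear combination
    of p and y. *)
Lemma half_series_generates z k c : S @ \oo --> z -> (1 <= k)%N ->
  cl_xA mul z (mul (x k) c).
Proof.
move=> Sz k1; have [y cy zE] := half_series_split Sz k1.
pose t : R := 2 ^- k.
have t0 : 0 < t by rewrite invr_gt0 exprn_gt0.
have t2 : 0 <= 2 * t <= 1.
  rewrite mulr_ge0 ?(ltW t0)//= /t -(prednK k1) exprS invfM mulrA mulfV// mul1r.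
  by rewrite invf_le1 ?exprn_gt0// exprn_ege1// ler1n.
have cxy := contractive1_convex Amul t2 (xF k1) cy.
set p := _ + _ in cxy.
have pyz : p + y = 2%:C *: z by rewrite zE /p -/t; unitization_ring.
pose c' := (2 * t)^-1%:C *: c.
have -> : mul (x k) c = mul p c' + mul y (- ((1 - 2 * t)%:C *: c')).
  have -> : c = (2 * t)%:C *: c'.
    by rewrite scalerA -rmorphM/= mulfV ?scale1r// gt_eqF// mulr_gt0.
  rewrite /p; unitization_ring.
apply: cl_xAD; apply: (@cl_xAZ _ 2%:C); rewrite -pyz; first exact: sum_generates.
by rewrite addrC; exact: sum_generates.
Qed.

End HalfSeries.

End Contractive.

(** * States, dissipativity and quasi-inverses of elements of r_A *)

Section RealPositive.
Variables (R : realType) (A : completeNormedModType R[i]) (mul : A -> A -> A).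
Hypothesis Amul : comm_banach_alg mul.
Implicit Types (a b c p q x y z : A).

Lemma nrZC (k : R[i]) a : nr (k *: a) = nr (k : R[i]^o) * nr a.
Proof. by apply: complexI; rewrite rmorphM/= -!nrE normrZ. Qed.

(** A bound on the multiplier norm of [v.1 + v.2 1], as a relation to avoid a supremum. If A has a
    unit [e], this is only a seminorm on pairs, null at [(e, -1)]. *)
Definition op_le (v : A * R[i]^o) (r : R) :=
  forall c, nr (mul v.1 c + v.2 *: c) <= r * nr c.

Lemma op_leZ (k : R[i]) v r : op_le v r -> op_le (k *: v) (nr (k : R[i]^o) * r).
Proof.
move=> vr c; have -> : mul (k *: v).1 c + (k *: v).2 *: c =
    k *: (mul v.1 c + v.2 *: c).
  by rewrite scalerDr scalerA (cmulZl Amul).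
by rewrite nrZC -mulrA ler_wpM2l ?nr_ge0.
Qed.

Lemma op_leD v w r s : op_le v r -> op_le w s -> op_le (v + w) (r + s).
Proof.
move=> vr ws c; have -> : mul (v + w).1 c + (v + w).2 *: c =
    (mul v.1 c + v.2 *: c) + (mul w.1 c + w.2 *: c).
  by rewrite (cmulDl Amul) scalerDl addrACA.
by rewrite mulrDl; apply: le_trans (ler_nrD _ _) _; exact: lerD.
Qed.

Lemma op_le_nr v : op_le v (nr v.1 + nr v.2).
Proof.
move=> c; apply: le_trans (ler_nrD _ _) _.
by rewrite mulrDl nrZC lerD2r; exact: nrM Amul _ _.
Qed.

Lemma op_le1 (s : R) : 0 <= s -> op_le (0, s%:C) s.
Proof. by move=> s0 c /=; rewrite cmul0l// add0r nrZ_ge0. Qed.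

(* inf (one_slopes v) is the one-sided derivative of the operator norm of the
   unitization at 1 in the direction v, as s (|1 + v/s| - 1) = |s + v| - s. *)
Definition one_slopes (v : A * R[i]^o) : set R :=
  [set m | exists s r, [/\ 0 <= s, op_le (v + (0, s%:C)) r & m = r - s]].

(** Writing s = (v + s) - v and applying both sides to [c] gives s |c| <= (r + |v|) |c|, where |c|
    can be cancelled. *)
Lemma one_slopes_lbound v c : c != 0 ->
  lbound (one_slopes v) (- (nr v.1 + nr v.2)).
Proof.
rewrite -nr_gt0 => c0 _ [s [r [s0 vr ->]]].
rewrite lerBrDr addrC lerBlDr -(ler_pM2r c0) -nrZ_ge0//.
have -> : s%:C *: c = (mul (v + (0, s%:C)).1 c + (v + (0, s%:C)).2 *: c)
    - (mul v.1 c + v.2 *: c).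
  by rewrite /= addr0 scalerDl addrA [RHS]addrAC subrr add0r.
apply: le_trans (ler_nrB _ _) _; rewrite mulrDl.
by apply: lerD; [exact: vr|exact: op_le_nr].
Qed.

Lemma one_slopes_sublinear c : c != 0 -> sublinear (fun v => inf (one_slopes v)).
Proof.
move=> c0; apply: inf_sublinear.
- move=> v; exists (nr v.1 + nr v.2 - 0), 0, (nr v.1 + nr v.2).
  by split=> //; rewrite addr0; exact: op_le_nr.
- by move=> v; eexists; exact: one_slopes_lbound c0.
- move=> v w _ _ [s [r [s0 vr ->]]] [s' [r' [s'0 vr' ->]]].
  exists (r + r' - (s + s')); last by lra.
  exists (s + s'), (r + r'); split=> //; first exact: addr_ge0.
  have := op_leD vr vr'; rewrite addrACA; congr (op_le (_ + _) _).
  by congr (_, _); rewrite /= ?addr0// rmorphD.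
- move=> t v _ t0 [s [r [s0 vr ->]]].
  exists (t * r - t * s); last by rewrite mulrBr.
  exists (t * s), (t * r); split=> //; first by rewrite mulr_ge0// ltW.
  have := op_leZ t%:C vr; rewrite scalerDr /nr normc_def/= expr0n/= addr0 sqrtr_sqr.
  rewrite gtr0_norm//; congr (op_le (_ + _) _).
  by congr (_, _); rewrite /= ?scaler0// rmorphM.
Qed.

Section State.
Variables (f : A * R[i]^o -> R[i]) (c0 : A).
Hypotheses (c0N0 : c0 != 0) (fD : forall v w, f (v + w) = f v + f w).
Hypotheses (fZ : forall k v, f (k *: v) = k * f v).
Hypothesis fle : forall v, Re (f v) <= inf (one_slopes v).

Lemma Re_slope_le v s r : 0 <= s -> op_le (v + (0, s%:C)) r -> Re (f v) <= r - s.
Proof.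
move=> s0 vr; apply: le_trans (fle v) _; apply: ge_inf; last by exists s, r.
by eexists; exact: one_slopes_lbound c0N0.
Qed.

(** Rotating [v] by a scalar [k] of modulus 1 with [k * f v = |f v|] reduces the claim to the slope
    at s = 0. *)
Lemma norm_state_le v r : op_le v r -> `|f v| <= r%:C.
Proof.
move=> vr; have r0 : 0 <= r.
  by have := le_trans (nr_ge0 _) (vr c0); rewrite pmulr_lge0 ?nr_gt0.
have [->|fv0] := eqVneq (f v) 0; first by rewrite normr0 ler0c.
pose k := `|f v| / f v.
have k1 : nr (k : R[i]^o) = 1.
  by rewrite /nr normrM normfV normr_id divff ?normr_eq0.
have := @Re_slope_le (k *: v) 0 r (lexx _); rewrite addr0 subr0 fZ.
have := op_leZ k vr; rewrite k1 mul1r => kr /(_ kr).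
by rewrite /k divfK// -lecR RRe_real ?normr_real.
Qed.

(** The slopes s = 0 at 1 and s = 1 at -1 force the real part to be 1; the modulus bound then kills
    the imaginary part. *)
Lemma state1 : f (0, 1) = 1.
Proof.
have f1 : Re (f (0, 1)) <= 1.
  have := @Re_slope_le (0, 1) 0 1 (lexx _); rewrite addr0 subr0; apply.
  exact: (op_le1 ler01).
have fN1 : Re (f (- (0, 1))) <= - 1.
  have := @Re_slope_le (- (0, 1)) 1 0 ler01; rewrite sub0r; apply.
  by rewrite addNr => c /=; rewrite cmul0l// scale0r addr0 nr0 mul0r.
have nf := norm_state_le (op_le1 ler01).
rewrite -scaleN1r fZ mulN1r in fN1.
case: (f (0, 1)) f1 fN1 nf => [s t] /= s1 sN1; rewrite normc_def lecR/=.
have -> : s = 1 by lra.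
move=> h; have : 1 ^+ 2 + t ^+ 2 <= 1.
  rewrite -(@sqr_sqrtr _ (1 ^+ 2 + t ^+ 2)) ?addr_ge0 ?sqr_ge0//.
  by rewrite expr_le1// sqrtr_ge0.
rewrite expr1n gerDl => t0; have /eqP : t ^+ 2 == 0 by rewrite eq_le t0 sqr_ge0.
by move/eqP; rewrite sqrf_eq0 => /eqP ->.
Qed.

Lemma stateE a k : f (a, k) = f (a, 0) + k.
Proof.
have -> : (a, k) = (a, 0) + k *: (0, 1) :> A * R[i]^o.
  by congr (_, _); rewrite /= ?scaler0 ?addr0// add0r /GRing.scale/= mulr1.
by rewrite fD fZ state1 mulr1.
Qed.

Lemma state_clinear : clinear (fun a => f (a, 0)).
Proof.
split=> [a b|k a].
  by rewrite -fD; congr f; congr (_, _); rewrite /= addr0.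
by rewrite -fZ; congr f; congr (_, _); rewrite /= scaler0.
Qed.

Lemma in_rA_state_ge0 y : in_rA mul y -> 0 <= Re (f (y, 0)).
Proof.
have f0 : op_le 0 0 by move=> c /=; rewrite cmul0l// scale0r addr0 nr0 mul0r.
move=> [yu yn]; rewrite -ler0c complexRe.
have [[e eid]|nu] := pselect (unital mul).
  have fe : f (e, 0) = 1.
    (* The pair [(e, -1)] acts as zero on A, so [f] factors through A itself. *)
    have : `|f (e, -1)| <= 0%:C.
      apply: norm_state_le => c /=; rewrite (eid.1 c).1 scaleN1r subrr nr0 mul0r.
      exact: lexx.
    by rewrite normr_le0 stateE subr_eq0 => /eqP.
  apply: (yu e eid (fun a => f (a, 0))); split=> //.
  - exact: state_clinear.
  - move=> b; rewrite nrE; apply: norm_state_le => c /=.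
    by rewrite scale0r addr0 (nrM Amul).
  - move=> eps eps0; exists e; rewrite eid.2 fe normr1; split=> //.
    by rewrite gtrBl.
apply: (yn nu (fun a => f (a, 0))); split.
- exact: state_clinear.
- move=> a k r akr; have r0 : 0 <= r.
    by have := akr 0; rewrite normr0 cmul0r// scaler0 addr0 normr0 => /(_ ler01).
  have rE : r = (Re r)%:C by rewrite RRe_real// ger0_real.
  rewrite -stateE rE; apply: norm_state_le.
  by apply/mnorm_leP => //; [rewrite -ler0c -rE|rewrite -rE].
- move=> eps eps0; exists 0, 1; rewrite -stateE state1 normr1; split.
    by move=> c c1; rewrite cmul0l// add0r scale1r.
  by rewrite gtrBl.
Qed.

End State.

(** Hahn-Banach gives a state [f] for which Re f(-y) is the derivative of the norm at 1 towards -y.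
    It is <= 0 as y is in r_A, so some slope is below [e]. *)
Lemma in_rA_dissipative y (e : R) : in_rA mul y -> 0 < e ->
  exists2 s : R, 0 <= s & forall c, nr (s%:C *: c - mul y c) <= (s + e) * nr c.
Proof.
(* In the zero algebra the slopes have no lower bound, so this case is settled apart. *)
move=> ry e0; have [[c0 c0N0]|A0] := pselect (exists c, c != 0); last first.
  exists 0 => // c; have [->|cN0] := eqVneq c 0; last by case: A0; exists c.
  by rewrite cmul0r// scaler0 subrr nr0 mulr0.
have [f [fD fZ fle fy]] :=
  hahn_banach ((- y, 0) : A * R[i]^o) (one_slopes_sublinear c0N0).
have p0 : inf (one_slopes (- y, 0)) <= 0.
  rewrite -fy; have := in_rA_state_ge0 c0N0 fD fZ fle ry.
  have -> : (- y, 0) = (-1) *: (y, 0) :> A * R[i]^o.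
    by congr (_, _); rewrite /= ?scaleN1r ?oppr0.
  by rewrite fZ mulN1r; case: (f _) => a b /=; rewrite oppr_le0.
have [|_ [s [r [s0 yr ->]]] rse] := @inf_adherent _ (one_slopes (- y, 0)) e e0.
  split; last by eexists; exact: one_slopes_lbound c0N0.
  pose r := nr (- y) + nr (0 : R[i]^o); exists (r - 0), 0, r.
  by split=> //; rewrite addr0; exact: op_le_nr.
exists s => // c; apply: le_trans (_ : r * nr c <= _); last first.
  by apply: ler_wpM2r; [exact: nr_ge0|lra].
have := yr c; rewrite /= addr0 add0r addrC; congr (nr (_ + _) <= _).
by unitization_ring.
Qed.

(** From (s + 1) c = (s - y) c + (1 + y) c follows (s + 1) |c| <= (s + e) |c| + |c + y c|; [s]
    cancels and [e] tends to 0. *)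
Lemma dissipative_ge y c : in_rA mul y -> nr c <= nr (c + mul y c).
Proof.
move=> ry; apply: (@ler_addgtMP _ _ _ (nr c)) => e e0.
have [s s0 /(_ c) sy] := in_rA_dissipative ry e0.
have := ler_nrD (s%:C *: c - mul y c) (c + mul y c).
have -> : s%:C *: c - mul y c + (c + mul y c) = (s + 1)%:C *: c by unitization_ring.
by rewrite nrZ_ge0 ?addr_ge0//; lra.
Qed.

(* x is y (1 + y)^-1, the fixed point of a contraction because |s - y| < s + 1
   for some s >= 0. *)
Lemma in_rA_quasi_inverse y : in_rA mul y ->
  exists2 x, contractive1 mul x & x + mul y x = y.
Proof.
move=> ry; suff [x xy] : exists x, x + mul y x = y.
  (* Here 1 - x is inverse to 1 + y, which by [dissipative_ge] does not decrease norms. *)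
  exists x => // c; apply: le_trans (dissipative_ge (c - mul x c) ry) _.
  have -> : c - mul x c + mul y (c - mul x c) = c + mul y c - mul (x + mul y x) c.
    by unitization_ring.
  by rewrite xy addrK.
have h0 : 0 < 2^-1 :> R by lra.
have [s s0 sy] := in_rA_dissipative ry h0.
pose k : R := (s + 1)^-1; have k0 : 0 <= k by rewrite invr_ge0 addr_ge0.
(* The equation x + y x = y is rewritten as (s + 1) x = y + s x - y x; the Lipschitz constant is (s
   + 1/2) / (s + 1). *)
pose T x := k%:C *: (y + s%:C *: x - mul y x).
pose q := k * (s + 2^-1).
have q1 : 0 <= q < 1.
  rewrite mulr_ge0 ?addr_ge0 ?(ltW h0)//= /q /k mulrC ltr_pdivrMr; lra.
have Tq a b : nr (T a - T b) <= q * nr (a - b).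
  have -> : T a - T b = k%:C *: (s%:C *: (a - b) - mul y (a - b)).
    by rewrite /T; unitization_ring.
  by rewrite nrZ_ge0// -mulrA ler_wpM2l.
pose u n := iter n T 0.
have [|x /cvg_nrP ux] := @geometric_cvg _ _ u (nr (u 1 - u 0)) q q1.
  elim=> [|n IH]; first by rewrite mulr1.
  apply: le_trans (Tq _ _) _; rewrite exprS mulrCA ler_wpM2l//.
  by case/andP: q1.
have Tx : x = T x.
  apply/eqP; rewrite -subr_eq0 -normr_le0 nrE lecR.
  apply: (@ler_addgtMP _ _ _ 2) => e e0; have [N uN] := ux e e0.
  have := uN N (leqnn _); have := uN N.+1 (leqnSn _).
  have := ler_nr_distD (u N.+1) x (T x); have := Tq (u N) x.
  rewrite -/(u N.+1) (nr_distC (u N)) add0r.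
  have : q * nr (x - u N) <= nr (x - u N).
    by rewrite ler_piMl ?nr_ge0//; case/andP: q1 => _ /ltW.
  rewrite /u/= -/(u N); lra.
exists x; apply/eqP; rewrite -subr_eq0; apply/eqP.
have -> : x + mul y x - y = (s + 1)%:C *: x - (y + s%:C *: x - mul y x).
  by unitization_ring.
rewrite {1}Tx /T scalerA -rmorphM/= mulfV ?scale1r ?subrr// gt_eqF//; lra.
Qed.

End RealPositive.

(** * Closures of sums of ideals, and separable ideals *)

Section Ideals.
Variables (R : realType) (A : completeNormedModType R[i]) (mul : A -> A -> A).
Hypothesis Amul : comm_banach_alg mul.
Implicit Types (a b c p q x y z : A).

Lemma closure_sub_closed (T : topologicalType) (S C : set T) :
  closed C -> S `<=` C -> closure S `<=` C.
Proof. by move=> /closure_id cC SC; rewrite cC; exact: closureS. Qed.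

Lemma half_series_ideal_sum (x : nat -> A) z :
  (forall k, (1 <= k)%N -> contractive1 mul (x k)) ->
  (fun n => \sum_(1 <= k < n.+1) (2 ^- k : R)%:C *: x k) @ \oo --> z ->
  closure (ideal_sum mul x) = cl_xA mul z.
Proof.
move=> xF Sz; have zcl := @closed_closure _ (range (mul z)).
apply/seteqP; split.
  apply: closure_sub_closed => // _ [n [y [xy ->]]]; rewrite big_nat_cond.
  elim/big_ind: _ => [|a b|k /andP[/andP[k1 kn] _]].
  - exact: cl_xA0.
  - exact: cl_xAD.
  - have : cl_xA mul (x k) (y k) by apply: xy; rewrite k1.
    apply: closure_sub_closed => // _ [c _ <-].
    exact: half_series_generates Sz k1.
apply: closure_sub_closed; first exact: closed_closure.
move=> _ [c _ <-]; apply/closure_nrP => e e0.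
have c1 : 0 < 1 + nr c by rewrite ltr_pwDl// nr_ge0.
move/cvg_nrP: Sz => /(_ (e / (1 + nr c))); rewrite divr_gt0// => /(_ isT)[N zN].
(* Truncating z in z c leaves an element of the sum of the ideals. *)
exists (mul (\sum_(1 <= k < N.+1) (2 ^- k : R)%:C *: x k) c).
  exists N, (fun k => mul (x k) ((2 ^- k : R)%:C *: c)); split=> [k _|].
    exact: cl_xA_mem.
  rewrite (big_morph (mul^~ c) (fun a b => cmulDl Amul a b c) (cmul0l Amul c)).
  by apply: eq_bigr => k _; rewrite (cmulZl Amul) (cmulZr Amul).
rewrite !(cmulC Amul _ c); apply: le_lt_trans (nrM_dist Amul _ _ _) _.
have := zN N (leqnn N); rewrite ltr_pdivlMr//; set d := nr _ => de.
apply: le_lt_trans de; rewrite mulrC ler_wpM2l ?nr_ge0//; lra.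
Qed.

Lemma bai_in_rA_eventually (J : set A) (d : nat -> A) n (e : R) :
  bai_in_rA mul J -> (forall i, J (d i)) -> 0 < e ->
  exists y, [/\ J y, in_rA mul y &
    forall i, (i < n)%N -> nr (d i - mul y (d i)) < e].
Proof.
move=> [I [le [u [[[i0 _] lexx letr ledir] uJ _ ua]]]] dJ e0.
(* Asking for a whole tail of the net lets directedness treat the [d i] one at a time. *)
suff [j uj] : exists j, forall k, le j k ->
    forall i, (i < n)%N -> nr (d i - mul (u k) (d i)) < e.
  by exists (u j); split; [exact: (uJ j).1|exact: (uJ j).2|exact: uj].
elim: n => [|n [j uj]]; first by exists i0.
have [|j' uj'] := (ua (d n) (dJ n)).1 e%:C; first by rewrite ltcR.
have [k [jk j'k]] := ledir j j'; exists k => l kl i.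
rewrite ltnS leq_eqVlt => /predU1P[->|]; last by apply: uj; exact: letr kl.
by rewrite nr_distC -ltr_nr; apply: uj'; exact: letr kl.
Qed.

Lemma separable_ideal_principal (J : set A) : approx_unital mul ->
  closed_ideal mul J -> separable_set J -> bai_in_rA mul J ->
  exists2 x, contractive1 mul x & J = cl_xA mul x.
Proof.
move=> Aau [Jcl J0 JD JZ JM] [d [dJ Jd]] Jbai.
have /choice[y yP] : forall n, exists y, [/\ J y, in_rA mul y &
    forall i, (i < n)%N -> nr (d i - mul y (d i)) < n.+1%:R^-1].
  by move=> n; apply: bai_in_rA_eventually => //; rewrite invr_gt0.
have /choice[x xP] : forall n, exists x,
    contractive1 mul x /\ x + mul (y n) x = y n.
  move=> n; have [_ /(in_rA_quasi_inverse Amul)[x cx xy] _] := yP n.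
  by exists x.
have xF k : (1 <= k)%N -> contractive1 mul (x k) by move=> _; exact: (xP k).1.
have xJ n : J (x n).
  have [yJ _ _] := yP n.
  (* This form shows that [x n] is in J, an ideal containing [y n]. *)
  have -> : x n = y n + (-1) *: mul (y n) (x n).
    by rewrite scaleN1r -{1}(xP n).2 addrK.
  by apply: JD => //; apply: JZ; exact: (JM _ _ yJ).2.
have [z Sz] := half_series_cvg Aau xF.
exists z; first exact: half_series_contractive1 Sz.
have zJ : J z.
  rewrite (iffLR (closure_id _) Jcl); apply/closure_nrP => e e0.
  move/cvg_nrP: Sz => /(_ e e0)[N /(_ N (leqnn N))]; eexists; last by eassumption.
  by elim/big_ind: _ => // k _; exact: JZ.
apply/seteqP; split.
  apply: subset_trans Jd _; apply: closure_sub_closed; first exact: closed_closure.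
  move=> _ [i _ <-].
  (* Closing twice admits approximants that are themselves only in the closure of zA. *)
  rewrite /cl_xA (iffLR (closure_id _) (@closed_closure _ (range (mul z)))).
  apply/closure_nrP => e e0.
  (* Here [n > i] puts [d i] under the control of [y n] and gives [1 <= n], as [x 0] does not enter
     z; the other bound makes the error less than [e]. *)
  pose n := maxn i.+1 (Num.truncn e^-1).
  have [_ _ /(_ i)] := yP n; rewrite leq_max ltnSn => /(_ isT) yn.
  exists (mul (y n) (d i)).
    rewrite -(xP n).2.
    have -> : mul (x n + mul (y n) (x n)) (d i) = mul (x n) (d i + mul (y n) (d i)).
      by unitization_ring.
    by apply: half_series_generates Sz _; rewrite // leq_max.
  apply: lt_trans yn _; rewrite invf_plt ?posrE//.
  apply: lt_le_trans (truncnS_gt _) _; rewrite ler_nat ltnS; exact: leq_maxr.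
by apply: closure_sub_closed => // _ [c _ <-]; exact: (JM _ _ zJ).2.
Qed.

End Ideals.

Theorem theorem7p2 (R : realType) (A : completeNormedModType R[i])
    (mul : A -> A -> A) :
  comm_banach_alg mul -> approx_unital mul ->
  (forall J : set A,
     closed_ideal mul J -> separable_set J -> bai_in_rA mul J ->
     exists x : A, in_FA mul x /\ J = cl_xA mul x) /\
  (forall x : nat -> A,
     (forall k, (1 <= k)%N -> in_FA mul (x k)) ->
     exists z : A,
       (fun n => \sum_(1 <= k < n.+1) ((2 : R[i]) ^- k) *: x k) @ \oo --> z /\
       closure (ideal_sum mul x) = cl_xA mul z).
Proof.
move=> Amul Aau; split=> [J Jid Jsep Jbai|x xF].
  have [x cx ->] := separable_ideal_principal Amul Aau Jid Jsep Jbai.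
  by exists x; split=> //; apply/in_FA_contractive1.
have cx k : (1 <= k)%N -> contractive1 mul (x k).
  by move=> /xF /in_FA_contractive1; exact.
have [z Sz] := half_series_cvg Aau cx.
exists z; split; last exact: half_series_ideal_sum Sz.
(* The complex weights are the images of the real powers [2 ^- k]. *)
under eq_fun do under eq_bigr => k _ do
  rewrite -(rmorph_nat (real_complex R)) -rmorphXn -fmorphV.
exact: Sz.
Qed.
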